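(* Let $p\ge 1$, let $F=f+\psi$ be as in the context, with $p$th derivative of $f$ Lipschitz continuous with constant $L_p$, and suppose $F$ is uniformly convex of degree $p+1$ with constant $\sigma_{p+1}>0$. Let the inner accuracies $\{\delta_k\}_{k\ge1}$ be chosen according to the rule $$\delta_k := c\cdot\bigl(F(x_{k-2})-F(x_{k-1})\bigr),\qquad k\ge 2,$$ for some fixed $0\le c<\frac{p}{p+1}\omega_p^{-1/p}$, and $\delta_1\ge0$, where $$\omega_p=\max\Bigl\{\frac{(p+1)^2L_p}{p!\,\sigma_{p+1}},\,1\Bigr\}.$$ Then the sequence $\{x_k\}_{k\ge1}$ produced by Monotone Inexact Tensor Method II (described in the context) has the following linear rate of convergence: for all $k\ge1$, $$F(x_{k+1})-F^*\;\le\;\Bigl(1-\frac{p}{p+1}\omega_p^{-1/p}+c\Bigr)\bigl(F(x_{k-1})-F^*\bigr).$$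
   Context: Setting. $\mathbb{E}$ is a finite-dimensional real vector space with dual $\mathbb{E}^*$, and $\langle s,x\rangle$ is the value of $s\in\mathbb{E}^*$ at $x\in\mathbb{E}$. $B:\mathbb{E}\to\mathbb{E}^*$ is a fixed symmetric positive definite linear operator and $\|x\|=\langle Bx,x\rangle^{1/2}$. For a $p$-linear symmetric form, $\|D^pf(x)\|=\max_{\|h_i\|\le 1}D^pf(x)[h_1,\dots,h_p]$; $D^kf(x)[h]^k$ denotes the $k$th directional derivative along $h$ taken $k$ times. Problem: minimize $F(x)=f(x)+\psi(x)$ over $x\in\mathbb{E}$, where $\psi:\mathbb{E}\to\mathbb{R}\cup\{+\infty\}$ is proper closed convex and $f:\operatorname{dom}\psi\to\mathbb{R}$ is convex and (sufficiently many times, at least $p$ times) differentiable. A solution $x^*\in\operatorname{dom}\psi$ is assumed to exist; $F^*=F(x^* )$. Lipschitz assumption: $\|D^pf(x)-D^pf(y)\|\le L_p\|x-y\|$ for all $x,y\in\operatorname{dom}\psi$. Uniform convexity of degree $p+1$ with constant $\sigma_{p+1}$: for all $x,y\in\operatorname{dom}\psi$ and all subgradients $F'(x)\in\partial F(x)$, $$F(y)-F(x)-\langle F'(x),y-x\rangle\;\ge\;\frac{\sigma_{p+1}}{p+1}\|y-x\|^{p+1}.$$ Model: for $H\ge 0$, $$\Omega_H(x;y)=f(x)+\sum_{k=1}^p\frac1{k!}D^kf(x)[y-x]^k+\frac{H\|y-x\|^{p+1}}{(p+1)!}+\psi(y).$$ Inexact monotone $\delta$-step: $M_{H,\delta}(x)$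 denotes any point $M\in\operatorname{dom}\psi$ satisfying both $\Omega_H(x;M)-\min_y\Omega_H(x;y)\le\delta$ and $F(M)<F(x)$. Monotone Inexact Tensor Method II: choose $x_0\in\operatorname{dom}\psi$, fix $H:=pL_p$. For $k=0,1,2,\dots$: given $\delta_{k+1}\ge0$, compute $x_{k+1}:=M_{H,\delta_{k+1}}(x_k)$. *)

(* Defs.v *)
From mathcomp Require Export all_boot all_order all_algebra.
From mathcomp Require Export all_classical all_reals all_analysis.

Set Implicit Arguments.
Unset Strict Implicit.
Unset Printing Implicit Defensive.

Import Order.TTheory GRing.Theory Num.Theory.
Import numFieldNormedType.Exports.

Local Open Scope classical_set_scope.
Local Open Scope ring_scope.

Notation dual R E := 'Hom(E, R^o).

Section EuclideanStructure.
Context {R : realType} {E : vectType R} (B : 'Hom(E, dual R E)).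

Definition symmetric_operator : Prop := forall x y : E, B x y = B y x.

Definition positive_definite : Prop := forall x : E, x != 0 -> 0 < B x x.

Definition Bnorm (x : E) : R := Num.sqrt (B x x).

(* A vectType carries no topology in the library: the topology of E is the one
   induced by Bnorm (in finite dimension, the only Hausdorff vector topology). *)
Definition Bnbhs (x : E) : set_system E :=
  filter_from [set e : R | 0 < e] (fun e => [set y | Bnorm (y - x) < e]).

End EuclideanStructure.

Section ConvexAnalysis.
Context {R : realType} {E : vectType R} (B : 'Hom(E, dual R E)).
Local Open Scope ereal_scope.

Definition dom (psi : E -> \bar R) : set E := [set x | psi x < +oo].

Definition proper (psi : E -> \bar R) : Prop :=
  (forall x, psi x != -oo) /\ dom psi !=set0.

(* Closed functions are the lower semicontinuous ones; this is the library's
   [lower_semicontinuous] for the topology given by [Bnbhs]. *)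
Definition closed_function (psi : E -> \bar R) : Prop :=
  forall (x : E) (a : R), a%:E < psi x ->
    \forall y \near Bnbhs B x, a%:E < psi y.

(* The library's [convex_function] is for finite-valued functions; here
   0 * +oo = 0, so t = 0 and t = 1 impose nothing. *)
Definition convex_efunction (psi : E -> \bar R) : Prop :=
  forall (x y : E) (t : R), (0 <= t <= 1)%R ->
    psi (t *: x + (1 - t) *: y)%R <= t%:E * psi x + (1 - t)%:E * psi y.

Definition subdifferential (F : E -> \bar R) (x : E) : set (dual R E) :=
  [set s | forall y : E, F x + (s (y - x)%R)%:E <= F y].

Definition uniformly_convex (q : nat) (sigma : R) (F : E -> \bar R) : Prop :=
  forall (x y : E) (s : dual R E), dom F x -> dom F y ->
    subdifferential F x s ->
    (sigma / q%:R * Bnorm B (y - x) ^+ q)%:E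
      <= F y - F x - (s (y - x)%R)%:E.

Definition is_minimizer (F : E -> \bar R) (x : E) : Prop :=
  dom F x /\ forall y : E, F x <= F y.

End ConvexAnalysis.

Section Derivatives.
Context {R : realType} {E : vectType R} (B : 'Hom(E, dual R E)).

Definition symmetric_form (k : nat) (phi : k.-tuple E -> R) : Prop :=
  forall h h' : k.-tuple E, perm_eq h h' -> phi h = phi h'.

Definition multilinear_form (k : nat) (phi : k.-tuple E -> R) : Prop :=
  forall (i : 'I_k) (h : k.-tuple E),
    linear (fun v : E =>
      phi [tuple if j == i then v else tnth h j | j < k] : R^o).

(* The supremum is taken in \bar R, so it has no default value; it is a finite
   maximum when phi is multilinear and B is positive definite. *)
Definition form_norm (k : nat) (phi : k.-tuple E -> R) : \bar R :=
  ereal_sup [set (phi h)%:E |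
             h in [set h : k.-tuple E | forall i, Bnorm B (tnth h i) <= 1]].

(* Frechet derivative of g at x, for g defined only on X:
   (g y - g x - l (y - x)) / |y - x| tends to 0 as y tends to x in X. *)
Definition has_derivative_within (X : set E) (g : E -> R) (x : E)
    (l : E -> R) : Prop :=
  (fun y : E => (g y - g x - l (y - x)) / Bnorm B (y - x))
    @ within [set y | X y /\ y != x] (Bnbhs B x) --> (0 : R).

(* D k x is the k-th derivative of f at x, for k <= p and x in X.  Since f is a
   function on X, and X need not be open, derivatives are relative to X.  They
   are given as data because they are determined by f only when X is large
   enough (e.g. convex with nonempty interior); a function which is p times
   differentiable in a neighbourhood of X has its usual derivatives as D. *)
Definition derivatives_on (p : nat) (X : set E) (f : E -> R)
    (D : forall k : nat, E -> k.-tuple E -> R) : Prop :=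
  [/\ forall x, X x -> D 0 x [tuple] = f x,
      forall k x, (k <= p)%N -> X x ->
        symmetric_form (D k x) /\ multilinear_form (D k x)
    & forall k x (h : k.-tuple E), (k < p)%N -> X x ->
        has_derivative_within X (fun y => D k y h) x
          (fun v => D k.+1 x [tuple of v :: h])].

Definition lipschitz_form_on (k : nat) (X : set E) (L : R)
    (A : E -> k.-tuple E -> R) : Prop :=
  forall x y, X x -> X y ->
    (form_norm (fun h => A x h - A y h)%R <= (L * Bnorm B (x - y))%:E)%E.

End Derivatives.

Section TensorMethod.
Context {R : realType} {E : vectType R} (B : 'Hom(E, dual R E)).
Context (p : nat) (f : E -> R) (D : forall k : nat, E -> k.-tuple E -> R).
Context (psi : E -> \bar R).

(* Only the values of f on dom psi matter: F is +oo outside dom psi. *)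
Definition objective (x : E) : \bar R := ((f x)%:E + psi x)%E.

Definition model (H : R) (x y : E) : \bar R :=
  ((f x
    + \sum_(1 <= k < p.+1) (k`!%:R)^-1 * D x [tuple of nseq k (y - x)]
    + H * Bnorm B (y - x) ^+ p.+1 / (p.+1)`!%:R)%:E + psi y)%E.

(* The minimum of the model is written as an infimum in \bar R; under the
   standing assumptions it is attained, and an infimum equal to -oo would make
   the inequality false. *)
Definition monotone_inexact_step (H delta : R) (x M : E) : Prop :=
  [/\ dom psi M,
      (model H x M - ereal_inf (range (model H x)) <= delta%:E)%E
    & (objective M < objective x)%E].

(* The accuracy delta k is used to compute x k; delta 0 is not used. *)
Definition monotone_inexact_tensor_method_II (L : R) (delta : nat -> R)
    (x : nat -> E) : Prop :=
  dom psi (x 0%N) /\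
  forall k : nat, 0 <= delta k.+1 /\
    monotone_inexact_step (p%:R * L) (delta k.+1) (x k) (x k.+1).

End TensorMethod.

Definition omega {R : realType} (p : nat) (L sigma : R) : R :=
  Num.max ((p.+1)%:R ^+ 2 * L / (p`!%:R * sigma)) 1.

(* Main.v *)
(* Taylor's formula along segments gives |f(y) - T_x(y)| <= L |y - x|^(p+1) / (p+1)!,
   so with H = pL the model satisfies F(y) <= Omega_H(x; y) <= F(y) + (L / p!) |y - x|^(p+1).
   Hence F(x_(k+1)) <= F(y) + (L / p!) |y - x_k|^(p+1) + delta_(k+1) for every y, in particular
   for y = x_k + a (x* - x_k) with a = omega_p^(-1/p).  Uniform convexity at x*, where 0 is a
   subgradient, bounds |x* - x_k|^(p+1) by (p+1) / sigma * (F(x_k) - F* ), and a^p omega_p = 1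
   turns the sum into (1 - p/(p+1) a) (F(x_k) - F* ) + delta_(k+1); the rule for delta and
   monotonicity conclude. *)
Require Import Defs.
From mathcomp Require Import ring lra.

Import Order.TTheory GRing.Theory Num.Theory.
Import numFieldNormedType.Exports.

Local Open Scope classical_set_scope.
Local Open Scope ring_scope.

Set Implicit Arguments.
Unset Strict Implicit.
Unset Printing Implicit Defensive.

(** * Taylor's formula on the unit interval, with the remainder controlled by a Lipschitz bound at
    0 *)

Section TaylorUnitInterval.
Context {R : realType}.

(* dg is the derivative of g relative to [0, 1], one-sided at the end points; the
   product form avoids excluding s = t. *)
Definition has_derivative01 (g dg : R -> R) : Prop :=
  forall t : R, 0 <= t <= 1 -> forall e : R, 0 < e ->
    \forall s \near t, 0 <= s <= 1 ->
      `|g s - g t - (s - t) * dg t| <= e * `|s - t|.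

(** The derivative estimate with [e := 1] gives [|g s - g t| <= (1 + |dg t|) * |s - t|] for s near
    t. *)
Lemma has_derivative01_continuous (g dg : R -> R) :
  has_derivative01 g dg -> {within `[0, 1], continuous g}.
Proof.
move=> gdg; apply/subspace_continuousP => t; rewrite /= in_itv /= => t01.
apply/cvgrPdist_lt => e e0; rewrite near_withinE.
have d0 : 0 < 1 + `|dg t| by rewrite ltr_wpDr.
near=> s => s01; rewrite /= in_itv /= in s01.
have st : `|s - t| < e / (1 + `|dg t|).
  near: s; exact: (@cvgr_distC_lt _ _ _ _ _ id t cvg_id _ (divr_gt0 e0 d0)).
have : `|g s - g t - (s - t) * dg t| <= 1 * `|s - t|.
  by move: s01; near: s; apply: gdg.
rewrite mul1r distrC => h; rewrite ltr_pdivlMr // in st; apply: le_lt_trans st.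
rewrite mulrDr mulr1 -normrM -lerBlDr; apply: le_trans h; rewrite [X in _ <= X]distrC.
rewrite [`|g t - _|]distrC; exact: lerB_dist.
Unshelve. all: by end_near. Qed.

(** At an interior point every s near t lies in [0, 1], so the relative derivative is the ordinary
    two-sided one. *)
Lemma has_derivative01_is_derive (g dg : R -> R) (t : R) :
  has_derivative01 g dg -> 0 < t < 1 -> is_derive t 1 g (dg t).
Proof.
move=> gdg /andP[t0 t1].
suff: h^-1 *: ((g \o shift t) (h *: (1 : R)) - g t) @[h --> 0^'] --> dg t.
  by move=> c; apply: DeriveDef; [apply/cvg_ex; exists (dg t)|exact: cvg_lim].
apply/cvgrPdist_le => e e0.
have t01 : 0 <= t <= 1 by rewrite !ltW.
have near_t := gdg t t01 e e0.
have shift_t : (fun h : R => h + t) @ (0 : R)^' --> t.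
  rewrite -[X in _ --> X]add0r; apply: cvgD; last exact: cvg_cst.
  exact: cvg_within.
have := shift_t _ near_t; rewrite /= => near_h.
have near0 : \forall h \near (0 : R)^', 0 <= h + t <= 1.
  apply: (shift_t [set s | 0 <= s <= 1]).
  have : \forall s \near t, s \in `]0, 1[ by apply: near_in_itvoo; rewrite in_itv /= t0.
  apply: filterS => s /=; rewrite in_itv /= => /andP[s0 s1]; by rewrite !ltW.
near=> h.
have h0 : h != 0 by near: h; exact: nbhs_dnbhs_neq.
have h01 : 0 <= h + t <= 1 by near: h.
have : `|g (h + t) - g t - (h + t - t) * dg t| <= e * `|h + t - t|.
  by move: h01; near: h.
rewrite addrK /= -[h *: 1]/(h * 1) mulr1 => hh.
rewrite -[h^-1 *: _]/(h^-1 * _) distrC.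
rewrite -(ler_pM2r (_ : 0 < `|h|)) ?normr_gt0 // -normrM.
by rewrite mulrBl mulrAC mulVf // mul1r [dg t * _]mulrC.
Unshelve. all: by end_near. Qed.

(** The difference [g - Q] is continuous on [0, 1] with nonpositive derivative inside, hence
    nonincreasing, and it starts at a nonpositive value. *)
Lemma le_poly_of_derivative01 (g dg : R -> R) (Q : {poly R}) :
  has_derivative01 g dg -> g 0 <= Q.[0] ->
  (forall t : R, 0 <= t <= 1 -> dg t <= Q^`().[t]) ->
  forall t : R, 0 <= t <= 1 -> g t <= Q.[t].
Proof.
move=> gdg g0 dgQ t t01.
have gD (s : R) : s \in `]0, 1[ -> is_derive s 1 (g - horner Q) (dg s - Q^`().[s]).
  rewrite in_itv /= => s01; apply: is_deriveB.
  exact: has_derivative01_is_derive.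
have : (g - horner Q) t <= (g - horner Q) 0.
  apply: (@ler0_derive1_le_cc R (g - horner Q) 0 1).
  - by move=> s /gD [].
  - move=> s s01; have [_ d] := gD s s01; rewrite derive1E d subr_le0.
    by apply: dgQ; move: s01; rewrite in_itv /= => /andP[? ?]; rewrite !ltW.
  - move=> s; apply: cvgB.
      exact: has_derivative01_continuous gdg s.
    exact/continuous_subspaceT/continuous_horner.
  - by rewrite in_itv.
  - by rewrite in_itv /= lexx ler01.
  - by case/andP: t01.
by rewrite !fctE; lra.
Qed.

(** When [phi k] is the k-th derivative, this is the Taylor polynomial at 0 plus the remainder bound
    as one more monomial, so that a single polynomial serves as majorant. *)
Definition taylor_poly (phi : nat -> R -> R) (C : R) (p : nat) : {poly R} :=
  \sum_(k < p.+1) (phi k 0 / k`!%:R) *: 'X^k + (C / p.+1`!%:R) *: 'X^(p.+1).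

(** The factorials absorb the exponents, in the remainder monomial too, so differentiation only
    shifts the family; this drives the induction in [taylor_le]. *)
Lemma deriv_taylor_poly (phi : nat -> R -> R) (C : R) (p : nat) :
  (taylor_poly phi C p.+1)^`() = taylor_poly (fun k => phi k.+1) C p.
Proof.
have cancelE k (a : R) : (a / k.+1`!%:R) *: ('X^k *+ k.+1) = (a / k`!%:R) *: 'X^k.
  rewrite -(scaler_nat k.+1 'X^k) scalerA; congr (_ *: _).
  by rewrite factS natrM invfM mulrA mulrAC divfK ?pnatr_eq0.
rewrite /taylor_poly derivD derivZ derivXn /= cancelE; congr (_ + _).
rewrite big_ord_recl derivD derivZ derivXn /= mulr0n scaler0 add0r.
rewrite raddf_sum /=; apply: eq_bigr => k _.
by rewrite derivZ derivXn /= -cancelE.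
Qed.

(** Induction on p: the induction hypothesis for the shifted family bounds the derivative [phi 1],
    and comparison from t = 0 integrates that bound. For p = 0 the claim is the hypothesis
    itself. *)
Lemma taylor_le (p : nat) (phi : nat -> R -> R) (C : R) :
  (forall k, (k < p)%N -> has_derivative01 (phi k) (phi k.+1)) ->
  (forall t : R, 0 <= t <= 1 -> phi p t - phi p 0 <= C * t) ->
  forall t : R, 0 <= t <= 1 -> phi 0%N t <= (taylor_poly phi C p).[t].
Proof.
elim: p phi => [|p IH] phi dphi phip t t01.
  rewrite /taylor_poly big_ord1 !hornerE /= factE !divr1.
  by have := phip t t01; lra.
apply: (@le_poly_of_derivative01 _ (phi 1%N)) t t01; first exact: dphi.
  rewrite /taylor_poly big_ord_recl hornerD hornerD horner_sum big1 => [|k _].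
    by rewrite !(hornerZ, hornerXn, hornerC) expr0 expr0n !mulr0 !addr0 mulr1 factE divr1.
  by rewrite hornerZ hornerXn expr0n mulr0.
move=> t t01; rewrite deriv_taylor_poly; apply: IH => // k kp; exact: dphi.
Qed.

(** The one-sided estimate at t = 1, applied to [phi] and to its negative. *)
Lemma taylor_dist_le (p : nat) (phi : nat -> R -> R) (C : R) :
  (forall k, (k < p)%N -> has_derivative01 (phi k) (phi k.+1)) ->
  (forall t : R, 0 <= t <= 1 -> `|phi p t - phi p 0| <= C * t) ->
  `|phi 0%N 1 - \sum_(k < p.+1) phi k 0 / k`!%:R| <= C / p.+1`!%:R.
Proof.
move=> dphi phip.
have valE (h : nat -> R -> R) :
    (taylor_poly h C p).[1] = \sum_(k < p.+1) h k 0 / k`!%:R + C / p.+1`!%:R.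
  rewrite /taylor_poly !hornerE /= horner_sum expr1n mulr1; congr (_ + _).
  by apply: eq_bigr => k _; rewrite !hornerE /= expr1n mulr1.
have i1 : 0 <= (1 : R) <= 1 by rewrite ler01 lexx.
have up : phi 0%N 1 <= (taylor_poly phi C p).[1].
  by apply: taylor_le => // t /phip; rewrite ler_norml => /andP[].
have dn : - phi 0%N 1 <= (taylor_poly (fun k t => - phi k t) C p).[1].
  apply: (@taylor_le p (fun k t => - phi k t)) => // [k kp t t01 e e0|t /phip].
    apply: filterS (dphi k kp t t01 e e0) => s h /h; rewrite -normrN.
    by congr (`|_| <= _); ring.
  by rewrite ler_norml => /andP[+ _]; lra.
rewrite valE in up; rewrite valE /= in dn.
have sumN : \sum_(k < p.+1) - phi k 0 / k`!%:R = - \sum_(k < p.+1) phi k 0 / k`!%:R.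
  by rewrite -sumrN; apply: eq_bigr => k _; rewrite mulNr.
by rewrite sumN in dn; rewrite ler_norml; apply/andP; split; lra.
Qed.

End TaylorUnitInterval.

(** * The norm induced by [B] *)

Section Bnorm.
Context {R : realType} {E : vectType R} (B : 'Hom(E, dual R E)).

Lemma Bnorm_ge0 (d : E) : 0 <= Bnorm B d.
Proof. exact: sqrtr_ge0. Qed.

Lemma BnormZ (a : R) (d : E) : Bnorm B (a *: d) = `|a| * Bnorm B d.
Proof.
rewrite /Bnorm !linearZ /= scale_lfunE linearZ /=.
rewrite -[a *: (a *: _)]/(a * (a * _)) mulrA -expr2 sqrtrM ?sqr_ge0 //.
by rewrite sqrtr_sqr.
Qed.

Lemma Bnorm_gt0 (d : E) : positive_definite B -> d != 0 -> 0 < Bnorm B d.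
Proof. by move=> Bpos d0; rewrite sqrtr_gt0; exact: Bpos. Qed.

Lemma Bnorm0 : Bnorm B 0 = 0.
Proof. by rewrite -(scale0r 0) BnormZ normr0 mul0r. Qed.

End Bnorm.

(** * Multilinear forms on repeated arguments *)

Section MultilinearForms.
Context {R : realType} {E : vectType R} (B : 'Hom(E, dual R E)).

Lemma multilinear_formB (k : nat) (phi phi' : k.-tuple E -> R) :
  multilinear_form phi -> multilinear_form phi' ->
  multilinear_form (fun h => phi h - phi' h).
Proof.
move=> lphi lphi' i h a u v; rewrite lphi lphi'.
by rewrite -![_ *: _]/(_ * _); ring.
Qed.

Lemma multilinear_cons (k : nat) (phi : k.+1.-tuple E -> R) (h : k.-tuple E) :
  multilinear_form phi -> scalar (fun v => phi [tuple of v :: h]).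
Proof.
move=> lphi a u v; have := lphi ord0 [tuple of u :: h] a u v.
suff consE (w : E) :
    [tuple if j == ord0 then w else tnth [tuple of u :: h] j | j < k.+1]
    = [tuple of w :: h] by rewrite !consE.
apply: eq_from_tnth => j; rewrite tnth_mktuple; case: (unliftP ord0 j) => [i|] -> //=.
by rewrite !tnthS.
Qed.

(** Induction on k: with the first slot frozen the form is still multilinear, which yields [a ^+ k];
    linearity in the first slot supplies the last factor. *)
Lemma multilinear_nseqZ (k : nat) (phi : k.-tuple E -> R) (a : R) (d : E) :
  multilinear_form phi ->
  phi [tuple of nseq k (a *: d)] = a ^+ k * phi [tuple of nseq k d].
Proof.
elim: k phi => [|k IH] phi lphi.
  by rewrite expr0 mul1r; congr phi; apply: val_inj.
have nseqE (v : E) : [tuple of nseq k.+1 v] = [tuple of v :: [tuple of nseq k v]].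
  exact: val_inj.
have lcons v : multilinear_form (fun h : k.-tuple E => phi [tuple of v :: h]).
  move=> i h b u w; have := lphi (lift ord0 i) [tuple of v :: h] b u w.
  suff consE (z : E) :
      [tuple if j == lift ord0 i then z else tnth [tuple of v :: h] j | j < k.+1]
      = [tuple of v :: [tuple if j == i then z else tnth h j | j < k]].
    by rewrite !consE.
  apply: eq_from_tnth => j; rewrite tnth_mktuple; case: (unliftP ord0 j) => [l|] -> //.
  by rewrite !tnthS tnth_mktuple (inj_eq lift_inj).
rewrite !nseqE (IH (fun h => phi [tuple of a *: d :: h])) //.
have := multilinear_cons [tuple of nseq k d] lphi a d 0.
have -> : phi [tuple of 0 :: [tuple of nseq k d]] = 0.
  have := multilinear_cons [tuple of nseq k d] lphi (-1) 0 0.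
  by rewrite scaler0 add0r; lra.
by rewrite !addr0 => ->; rewrite exprSr mulrA.
Qed.

(** Rescale d to unit length and use homogeneity. The bound is one-sided because [form_norm] is a
    supremum of values without absolute values. *)
Lemma form_norm_nseq_le (k : nat) (phi : k.-tuple E -> R) (M : R) (d : E) :
  positive_definite B -> multilinear_form phi -> (form_norm B phi <= M%:E)%E ->
  phi [tuple of nseq k d] <= M * Bnorm B d ^+ k.
Proof.
move=> Bpos lphi phiM.
have unit_ball (u : E) : Bnorm B u <= 1 -> phi [tuple of nseq k u] <= M.
  move=> u1; rewrite -lee_fin; apply: le_trans phiM; apply: ereal_sup_ubound.
  by exists [tuple of nseq k u] => // i; rewrite tnth_nseq.
have [->|d0] := eqVneq d 0.
  (* Homogeneity with factor 0 produces [0 ^+ k], which is right for k = 0 as well, where it equals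
     1. *)
  have -> : [tuple of nseq k (0 : E)] = [tuple of nseq k (0 *: (0 : E))] by rewrite scaler0.
  rewrite multilinear_nseqZ // Bnorm0 mulrC ler_wpM2r ?exprn_ge0 //.
  by apply: unit_ball; rewrite Bnorm0.
have N0 := Bnorm_gt0 Bpos d0.
have -> : [tuple of nseq k d]
    = [tuple of nseq k (Bnorm B d *: ((Bnorm B d)^-1 *: d))].
  by rewrite scalerA divff ?scale1r // gt_eqF.
rewrite multilinear_nseqZ // mulrC.
apply: ler_wpM2r; first by rewrite exprn_ge0 ?ltW.
by apply: unit_ball; rewrite BnormZ gtr0_norm ?invr_gt0 // mulVf ?gt_eqF.
Qed.

End MultilinearForms.

(** * Taylor's formula along a segment of E *)

Section TaylorSegment.
Context {R : realType} {E : vectType R} (B : 'Hom(E, dual R E)).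

(** Chain rule for the affine path [x + t *: d], with derivatives relative to X and to [0, 1]. *)
Lemma has_derivative01_segment (X : set E) (g : E -> R) (l : R -> E -> R) (x d : E) :
  positive_definite B -> (forall t : R, 0 <= t <= 1 -> X (x + t *: d)) ->
  (forall t, 0 <= t <= 1 -> scalar (l t)) ->
  (forall t, 0 <= t <= 1 -> has_derivative_within B X g (x + t *: d) (l t)) ->
  has_derivative01 (fun t => g (x + t *: d)) (fun t => l t d).
Proof.
move=> Bpos Xseg l_linear dg t t01 e e0.
have l0 : l t 0 = 0 by have := l_linear t t01 (-1) 0 0; rewrite scaler0 add0r; lra.
have lZ (a : R) (v : E) : l t (a *: v) = a * l t v.
  by have := l_linear t t01 a v 0; rewrite l0 !addr0.
have N1 : 0 < 1 + Bnorm B d by rewrite ltr_wpDr ?Bnorm_ge0.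
(* The tolerance is divided by [1 + Bnorm B d] rather than [Bnorm B d], so that d = 0 is covered. *)
have e1 := divr_gt0 e0 N1.
have [r /= r0 rP] := dg t t01 _ (@nbhsx_ballx _ R^o 0 _ e1).
near=> s => s01.
have stE : x + s *: d - (x + t *: d) = (s - t) *: d.
  by rewrite opprD addrACA subrr add0r scalerBl.
(* The derivative within X is a limit over points different from the base point; when the two points
   coincide, the left side is 0. *)
have [sd|sd] := eqVneq (x + s *: d) (x + t *: d).
  rewrite -lZ -stE sd !subrr l0 subr0 normr0.
  exact: mulr_ge0 (ltW e0) (normr_ge0 _).
have st : `|s - t| < r / (1 + Bnorm B d).
  near: s; exact: (@cvgr_distC_lt _ _ _ _ _ id t cvg_id _ (divr_gt0 r0 N1)).
have := rP (x + s *: d); rewrite /= stE BnormZ.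
have -> : `|s - t| * Bnorm B d < r.
  rewrite ltr_pdivlMr // in st; apply: le_lt_trans st.
  by rewrite ler_wpM2l // lerDr ler01.
move=> /(_ isT (conj (Xseg s s01) sd)); rewrite /ball /= sub0r normrN lZ.
have std : 0 < `|s - t| * Bnorm B d.
  by rewrite -BnormZ Bnorm_gt0 // -stE subr_eq0.
rewrite normrM normfV [`|_ * Bnorm B d|]gtr0_norm // ltr_pdivrMr // => /ltW h.
apply: le_trans h _; rewrite mulrCA [e * _]mulrC; apply: ler_wpM2l => //.
rewrite mulrAC ler_pdivrMr // ler_wpM2l ?(ltW e0) // lerDr ler01.
Unshelve. all: by end_near. Qed.

(** Reduction to the unit interval: [phi k t] is the k-th derivative at [x + t *: d] on k copies of
    d, and the Lipschitz bound on [D p] gives the constant [C = L * Bnorm B d ^+ p.+1]. *)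
Lemma taylor_segment_dist_le (p : nat) (X : set E) (f : E -> R)
    (D : forall k : nat, E -> k.-tuple E -> R) (L : R) (x y : E) :
  positive_definite B -> derivatives_on B p X f D ->
  lipschitz_form_on B X L (D p) -> X x -> X y ->
  (forall t : R, 0 <= t <= 1 -> X (x + t *: (y - x))) ->
  `|f y - (f x + \sum_(1 <= k < p.+1) (k`!%:R)^-1 * D k x [tuple of nseq k (y - x)])|
    <= L * Bnorm B (y - x) ^+ p.+1 / p.+1`!%:R.
Proof.
move=> Bpos [D0 D_forms dD] DL Xx Xy Xseg; set d := y - x.
pose phi k t := D k (x + t *: d) [tuple of nseq k d].
have phiE0 t : 0 <= t <= 1 -> phi 0%N t = f (x + t *: d).
  by move=> /Xseg /D0 <-; rewrite /phi; congr (D _ _ _); apply: val_inj.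
have i1 : 0 <= (1 : R) <= 1 by rewrite ler01 lexx.
have i0 : 0 <= (0 : R) <= 1 by rewrite ler01 lexx.
have x0E : x + 0 *: d = x by rewrite scale0r addr0.
have := @taylor_dist_le _ p phi (L * Bnorm B d ^+ p.+1).
rewrite phiE0 // scale1r subrKC big_ord_recl phiE0 // x0E factE divr1.
have -> : \sum_(1 <= k < p.+1) (k`!%:R)^-1 * D k x [tuple of nseq k d]
    = \sum_(k < p) phi (lift ord0 k) 0 / (lift ord0 k)`!%:R.
  rewrite big_add1 big_mkord; apply: eq_bigr => k _.
  by rewrite /phi x0E mulrC.
apply => [k kp|t t01].
  have -> : phi k.+1 =
      fun t => D k.+1 (x + t *: d) [tuple of d :: [tuple of nseq k d]].
    by apply/funext => t; rewrite /phi; congr (D _ _ _); apply: val_inj.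
  apply: (@has_derivative01_segment X (fun z => D k z [tuple of nseq k d])
    (fun t v => D k.+1 (x + t *: d) [tuple of v :: [tuple of nseq k d]])) => // t t01.
    by apply: multilinear_cons; apply: (D_forms _ _ kp (Xseg t t01)).2.
  exact: (dD k _ [tuple of nseq k d] kp (Xseg t t01)).
have Dlin z : X z -> multilinear_form (D p z) by move=> /(D_forms _ _ (leqnn p)) [].
(* The two-sided estimate comes from this one-sided bound used twice, with u and v exchanged. *)
have bound u v : X u -> X v ->
    D p u [tuple of nseq p d] - D p v [tuple of nseq p d]
      <= L * Bnorm B (u - v) * Bnorm B d ^+ p.
  move=> Xu Xv.
  apply: (form_norm_nseq_le (phi := fun h => D p u h - D p v h)) => //.
    by apply: multilinear_formB; exact: Dlin.
  exact: DL.
have tN : Bnorm B (t *: d) = t * Bnorm B d.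
  by rewrite BnormZ ger0_norm //; case/andP: t01.
have up := bound _ _ (Xseg t t01) (Xseg 0 i0).
have dn := bound _ _ (Xseg 0 i0) (Xseg t t01).
rewrite !x0E addrAC subrr add0r tN in up.
rewrite !x0E opprD addNKr -scaleNr BnormZ normrN -BnormZ tN in dn.
have RE : L * (t * Bnorm B d) * Bnorm B d ^+ p = L * Bnorm B d ^+ p.+1 * t.
  by rewrite exprS; ring.
rewrite RE in up; rewrite RE in dn.
by rewrite /phi x0E ler_norml; apply/andP; split; lra.
Qed.

End TaylorSegment.

Lemma mix_sub {R : pzRingType} {E : lmodType R} (t : R) (x y : E) :
  t *: y + (1 - t) *: x = x + t *: (y - x).
Proof. by rewrite scalerBl scale1r scalerBr addrCA. Qed.

(** * The step length [omega ^ (-1/p)] *)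

Section OmegaPower.
Context {R : realType} (p : nat) (L sigma : R).

Let w := omega p L sigma.

Lemma omega_ge1 : 1 <= w.
Proof. by rewrite le_max lexx orbT. Qed.

Lemma le_omega : 0 < sigma -> L <= w * p`!%:R * sigma / p.+1%:R ^+ 2.
Proof.
move=> s0.
have d0 : 0 < p`!%:R * sigma by rewrite mulr_gt0 // ltr0n fact_gt0.
have : p.+1%:R ^+ 2 * L / (p`!%:R * sigma) <= w by rewrite le_max lexx.
rewrite ler_pdivrMr // => h; rewrite ler_pdivlMr ?exprn_gt0 ?ltr0n //.
by rewrite mulrC -mulrA.
Qed.

Lemma omega_powR_gt0 : 0 < w `^ (- p%:R^-1).
Proof. by rewrite powR_gt0 // (lt_le_trans ltr01) // omega_ge1. Qed.

Lemma omega_powR_le1 : w `^ (- p%:R^-1) <= 1.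
Proof.
by rewrite -[leRHS](powRr0 w) ler_powR ?omega_ge1 // oppr_le0 invr_ge0 ler0n.
Qed.

(** This identity fixes the choice of step length: it cancels [omega] against the p-th power of the
    step. *)
Lemma omega_powRX : (0 < p)%N -> (w `^ (- p%:R^-1)) ^+ p * w = 1.
Proof.
move=> p0; have w0 : 0 < w by rewrite (lt_le_trans ltr01) // omega_ge1.
rewrite -powR_mulrn ?powR_ge0 // -powRrM mulNr mulVf ?pnatr_eq0 ?gt_eqF //.
by rewrite powR_inv1 ?ltW // mulVf // gt_eqF.
Qed.

End OmegaPower.

(** * Passing from extended to real values on the domain, and convexity along segments *)

Section ConvexDomain.
Context {R : realType} {E : vectType R} (f : E -> R) (psi : E -> \bar R).
Hypotheses (psi_proper : proper psi) (psi_convex : convex_efunction psi).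

Lemma proper_fineK (x : E) : dom psi x -> psi x = (fine (psi x))%:E.
Proof.
by move=> psix; rewrite fineK // fin_numE psi_proper.1 /= lt_eqF.
Qed.

Lemma objectiveE (x : E) : dom psi x -> objective f psi x = (f x + fine (psi x))%:E.
Proof. by move=> psix; rewrite /objective {1}proper_fineK. Qed.

Lemma dom_objective : dom (objective f psi) = dom psi.
Proof.
apply/seteqP; split => x; rewrite /dom /objective /=.
  by have := psi_proper.1 x; case: (psi x) => [r _ _|_ /=|]; rewrite ?ltry ?addey ?ltxx.
by move=> psix; rewrite proper_fineK // -EFinD ltry.
Qed.

(** Convexity bounds the intermediate value by a finite number; this puts the point in the domain,
    after which the same inequality can be read in the reals. *)
Lemma fine_psi_segment (x y : E) (t : R) : dom psi x -> dom psi y -> 0 <= t <= 1 ->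
  dom psi (x + t *: (y - x)) /\
  fine (psi (x + t *: (y - x))) <= t * fine (psi y) + (1 - t) * fine (psi x).
Proof.
move=> Dx Dy t01; rewrite -mix_sub.
have := psi_convex y x t01.
rewrite (proper_fineK Dx) (proper_fineK Dy) -!EFinM -EFinD /= => h.
have Dz : dom psi (t *: y + (1 - t) *: x) by apply: le_lt_trans h (ltry _).
by split => //; rewrite -lee_fin -proper_fineK.
Qed.

Lemma convex_function_segment (x y : E) (t : R) : convex_function (dom psi) f ->
  dom psi x -> dom psi y -> 0 <= t <= 1 ->
  f (x + t *: (y - x)) <= t * f y + (1 - t) * f x.
Proof.
move=> fconv Dx Dy /andP[t0 t1]; rewrite -mix_sub.
exact: (fconv (Itv01 t0 t1) y x (mem_set Dy) (mem_set Dx)).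
Qed.

End ConvexDomain.

(** * Decrease of the objective in one inexact tensor step *)

Section TensorStep.
Context {R : realType} {E : vectType R} (B : 'Hom(E, dual R E)).
Context (p : nat) (f : E -> R) (D : forall k : nat, E -> k.-tuple E -> R).
Context (psi : E -> \bar R) (L : R).
Hypotheses (B_pos : positive_definite B) (p_gt0 : (0 < p)%N).
Hypotheses (psi_proper : proper psi) (psi_convex : convex_efunction psi).
Hypothesis f_derivatives : derivatives_on B p (dom psi) f D.
Hypothesis f_lipschitz : lipschitz_form_on B (dom psi) L (@D p).

(* The real value of the objective, meaningful on dom psi only. *)
Let Fr (y : E) : R := f y + fine (psi y).

(** Let K be the Taylor error bound. The regularizer with H = pL equals pK, which dominates the
    error since p is at least 1; from above, error and regularizer add up to
    [(p + 1) K = L / p! * |y - x|^(p+1)]. *)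
Lemma model_bounds (x y : E) : dom psi x -> dom psi y ->
  exists2 m : R, model B p f D psi (p%:R * L) x y = m%:E
    & Fr y <= m <= Fr y + L / p`!%:R * Bnorm B (y - x) ^+ p.+1.
Proof.
move=> Dx Dy; rewrite /model (proper_fineK psi_proper Dy) -EFinD.
eexists; first reflexivity.
have xyD t : 0 <= t <= 1 -> dom psi (x + t *: (y - x)).
  by move=> /(fine_psi_segment psi_proper psi_convex Dx Dy)[].
have := taylor_segment_dist_le B_pos f_derivatives f_lipschitz Dx Dy xyD.
set T := f x + _; set q := Bnorm B (y - x) ^+ p.+1 => h.
set K := L * q / p.+1`!%:R in h.
(* K bounds an absolute value, so it is nonnegative whatever the sign of [L]. *)
have K0 : 0 <= K by apply: le_trans h.
have -> : p%:R * L * q / p.+1`!%:R = p%:R * K by rewrite /K !mulrA.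
have -> : L / p`!%:R * q = p%:R * K + K.
  rewrite /K factS natrM -natr1; field.
  by rewrite natr1 !pnatr_eq0 -lt0n fact_gt0.
have Kp : K <= p%:R * K by rewrite ler_peMl // ler1n.
by move: h; rewrite ler_norml /Fr => /andP[h1 h2]; apply/andP; split; lra.
Qed.

Lemma inexact_step_le (delta : R) (x M y : E) :
  dom psi x -> dom psi y ->
  monotone_inexact_step B p f D psi (p%:R * L) delta x M ->
  Fr M <= Fr y + L / p`!%:R * Bnorm B (y - x) ^+ p.+1 + delta.
Proof.
move=> Dx Dy [DM Mdelta _].
have [mM mME /andP[FM _]] := model_bounds Dx DM.
have [my myE /andP[_ Fy]] := model_bounds Dx Dy.
(* The infimum of the model is at most its value at y, so the accuracy condition survives replacing
   the infimum by that value. *)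
have : (mM%:E - my%:E <= delta%:E)%E.
  apply: le_trans Mdelta; rewrite mME leeB // -myE.
  by apply: ereal_inf_lbound; exists y.
by rewrite -EFinB lee_fin; lra.
Qed.

Lemma inexact_step_linear (sigma delta : R) (xstar x M : E) :
  convex_function (dom psi) f ->
  is_minimizer (objective f psi) xstar -> 0 < sigma ->
  uniformly_convex B p.+1 sigma (objective f psi) ->
  dom psi x ->
  monotone_inexact_step B p f D psi (p%:R * L) delta x M ->
  Fr M - Fr xstar <=
    (1 - p%:R / p.+1%:R * omega p L sigma `^ (- p%:R^-1)) * (Fr x - Fr xstar) + delta.
Proof.
move=> fconv [Ds s_min] sigma0 Funif Dx step.
have Ds' : dom psi xstar by rewrite -(dom_objective f psi_proper).
set a := omega p L sigma `^ _.
have a0 : 0 < a := omega_powR_gt0 p L sigma.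
have a01 : 0 <= a <= 1 by rewrite ltW // omega_powR_le1.
have aw : a ^+ p * omega p L sigma = 1 := omega_powRX L sigma p_gt0.
have w1 := omega_ge1 p L sigma.
have Lw := le_omega p L sigma0.
have [Dy psiy] := fine_psi_segment psi_proper psi_convex Dx Ds' a01.
have fy := convex_function_segment fconv Dx Ds' a01.
have := inexact_step_le Dx Dy step.
rewrite [x + _ *: _ - x]addrC addKr BnormZ (ger0_norm (ltW a0)) exprMn exprSr.
(* The zero functional is a subgradient at the minimizer, so the distance to [xstar] is controlled
   by the objective gap. *)
have := Funif xstar x 0.
rewrite !(objectiveE f psi_proper) // !lfunE /= sube0 -EFinB lee_fin.
rewrite (dom_objective f psi_proper) => /(_ Ds' Dx).
have -> : Bnorm B (x - xstar) = Bnorm B (xstar - x).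
  by rewrite -opprB -scaleN1r BnormZ normrN1 mul1r.
have p1 : 0 < p.+1%:R :> R by rewrite ltr0n.
have f0 : 0 < p`!%:R :> R by rewrite ltr0n fact_gt0.
move: aw w1 Lw psiy fy p1 f0; rewrite /Fr; move: (omega _ _ _) => w.
set q := Bnorm B _ ^+ p.+1.
have q0 : 0 <= q by rewrite exprn_ge0 // Bnorm_ge0.
set Fx := f x + _; set Fs := f xstar + _.
move=> aw w1 Lw psiy fy p1 f0 Fq hM.
have {}Fq : sigma / p.+1%:R * q <= Fx - Fs.
  apply: Fq => y; rewrite lfunE /= adde0; exact: s_min.
(* Of the two factors p + 1 in [omega], one cancels that of uniform convexity and the other remains
   as a denominator. *)
have Lq : L / p`!%:R * q <= w / p.+1%:R * (Fx - Fs).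
  apply: (@le_trans _ _ (w / p.+1%:R * (sigma / p.+1%:R * q))).
    have -> : w / p.+1%:R * (sigma / p.+1%:R * q)
        = w * p`!%:R * sigma / p.+1%:R ^+ 2 / p`!%:R * q.
      by field; rewrite !gt_eqF.
    by apply: ler_wpM2r => //; apply: ler_wpM2r Lw; rewrite invr_ge0 ltW.
  by apply: ler_wpM2l Fq; rewrite divr_ge0 ?ltW // (lt_le_trans ltr01).
have aLq : L / p`!%:R * (a ^+ p * a * q) <= a / p.+1%:R * (Fx - Fs).
  have -> : a / p.+1%:R * (Fx - Fs) = a ^+ p * a * (w / p.+1%:R * (Fx - Fs)).
    by rewrite -[in LHS](mulr1 a) -aw; ring.
  rewrite mulrCA; apply: ler_wpM2l => //.
  by rewrite mulr_ge0 ?exprn_ge0 ?ltW.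
(* The net gain: a from convexity along the segment, minus [a / (p + 1)] lost to the regularization
   term. *)
have pE : p%:R / p.+1%:R * a = a - a / p.+1%:R.
  have -> : (p%:R : R) = p.+1%:R - 1 by rewrite -natr1 addrK.
  by field; rewrite gt_eqF.
have Fmix : f (x + a *: (xstar - x)) + fine (psi (x + a *: (xstar - x)))
    <= a * Fs + (1 - a) * Fx.
  by rewrite /Fs /Fx; lra.
apply: le_trans (lerB hM (lexx Fs)) _.
move: Fmix aLq; rewrite pE; move: (L / _ * _) (a / _) => u v; lra.
Qed.

End TensorStep.

(** * Linear convergence under the dynamic accuracy rule *)

Theorem theorem3 (R : realType) (E : vectType R) (B : 'Hom(E, dual R E))
  (p : nat) (f : E -> R) (D : forall k : nat, E -> k.-tuple E -> R)
  (psi : E -> \bar R) (Lp sigma c : R) (xstar : E)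
  (delta : nat -> R) (x : nat -> E)
  (F := objective f psi)
  (theta := p%:R / (p.+1)%:R * omega p Lp sigma `^ (- (p%:R)^-1))
  (B_sym : symmetric_operator B)
  (B_pos : positive_definite B)
  (p_ge1 : (1 <= p)%N)
  (psi_proper : proper psi)
  (psi_closed : closed_function B psi)
  (psi_convex : convex_efunction psi)
  (f_convex : convex_function (dom psi) f)
  (f_derivatives : derivatives_on B p (dom psi) f D)
  (f_lipschitz : lipschitz_form_on B (dom psi) Lp (D p))
  (xstar_solution : is_minimizer F xstar)
  (sigma_gt0 : 0 < sigma)
  (F_uconvex : uniformly_convex B p.+1 sigma F)
  (c_bounds : 0 <= c < theta)
  (delta1_ge0 : 0 <= delta 1%N)
  (delta_rule : forall k : nat, (2 <= k)%N ->
     (delta k)%:E = (c%:E * (F (x (k - 2)%N) - F (x (k - 1)%N)))%E)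
  (x_method : monotone_inexact_tensor_method_II B p f D psi Lp delta x) :
  forall k : nat, (1 <= k)%N ->
    (F (x k.+1) - F xstar
      <= (1 - theta + c)%:E * (F (x (k - 1)%N) - F xstar))%E.
Proof.
have [x0_dom steps] := x_method.
have x_dom k : dom psi (x k) by case: k => [|k] //; have [_ []] := steps k.
have FE y : dom psi y -> F y = (f y + fine (psi y))%:E.
  exact: objectiveE.
have xstar_dom : dom psi xstar.
  by rewrite -(dom_objective f psi_proper); exact: xstar_solution.1.
case=> [//|k] _; rewrite subn1 /=.
(* After the shift of k, the relevant step goes from [x k.+1] to [x k.+2]; its accuracy is c times
   the decrease achieved by the step before it. *)
have := delta_rule k.+2 isT.
have [_ step] := steps k.+1.
have [_ [_ _]] := steps k; rewrite -/F.
have := xstar_solution.2 (x k); rewrite -/F.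
rewrite subn2 subn1 /= !FE // -!EFinB -!EFinM !lee_fin lte_fin => min_k decr [deltaE].
have := inexact_step_linear B_pos p_ge1 psi_proper psi_convex f_derivatives
  f_lipschitz f_convex xstar_solution sigma_gt0 F_uconvex (x_dom k.+1) step.
rewrite -/theta deltaE => rec.
(* The coefficient [1 - theta] must be nonnegative for monotonicity to replace the gap at [x k.+1]
   by the gap at [x k]. *)
have theta_le1 : theta <= 1.
  have := omega_powR_le1 p Lp sigma; apply: mulr_ile1.
  - by rewrite divr_ge0.
  - exact: powR_ge0.
  - by rewrite ler_pdivrMr ?ltr0n // mul1r ler_nat.
have /andP[c0 _] := c_bounds.
apply: le_trans rec _; rewrite [leRHS]mulrDl; apply: lerD.
  by rewrite ler_wpM2l ?subr_ge0 // lerB // ltW.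
(* Minimality bounds the decrease from [x k] to [x k.+1] by the whole gap at [x k], which accounts
   for the term c in the rate. *)
have xstar_min : f xstar + fine (psi xstar) <= f (x k.+1) + fine (psi (x k.+1)).
  by have := xstar_solution.2 (x k.+1); rewrite -/F !FE // lee_fin.
by rewrite ler_wpM2l // lerB.
Qed.
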